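(* For $\theta=(\theta_1,\dots,\theta_n)\in\mathbb{R}^{nd}$, let $V(\theta)$ be the value of the optimization problem $$V(\theta)=\inf_{\dot s_0,\dots,\dot s_N\ge 0}\left(\sum_{i=0}^{N-1}\frac{\Delta s_i}{\sqrt{\dot s_i^2}}\right)^2\quad\text{subject to}\quad -\dot{\underline q}_j^2\le\operatorname{sign}(p_i'\theta_j)(p_i'\theta_j)^2\dot s_i^2\le\dot{\overline q}_j^2,\quad i=0,\dots,N,\ j=1,\dots,n.$$ If the velocity limits satisfy $\dot{\underline q}_j<0$ and $\dot{\overline q}_j>0$ for all $j=1,\dots,n$, then $$V(\theta)=\left(\sum_{i=0}^{N-1}\max_{j\in\{1,\dots,n\}}\max\left\{\frac{\Delta s_i\,p_i'\theta_j}{\dot{\overline q}_j},\ \frac{\Delta s_i\,p_i'\theta_j}{\dot{\underline q}_j}\right\}\right)^2.$$ Furthermore, $V$ is a convex function of $\theta\in\mathbb{R}^{nd}$.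
   Context: $N,n,d$ are positive integers. $0=s_0<s_1<\dots<s_N=1$ are path points and $\Delta s_i=s_{i+1}-s_i>0$. The function $p:\mathbb{R}\to\mathbb{R}^{1\times d}$ is a twice differentiable row-vector basis; $p_i'=p'(s_i)$ and $\theta_j\in\mathbb{R}^d$, so $p_i'\theta_j\in\mathbb{R}$. For each joint $j$, the real constants $\dot{\underline q}_j,\dot{\overline q}_j$ are the lower and upper velocity limits. $\operatorname{sign}(0)=0$. The objective is $+\infty$ when some $\dot s_i=0$, $0\le i\le N-1$, and the value of the problem is its infimum (which need not be attained). *)

(* Defs.v *)
From HB Require Import structures.
From mathcomp Require Export all_boot all_order all_algebra.
From mathcomp Require Export all_classical all_reals all_analysis.

Set Implicit Arguments.
Unset Strict Implicit.
Unset Printing Implicit Defensive.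

Export Order.TTheory GRing.Theory Num.Theory.
Export numFieldNormedType.Exports.

Local Open Scope classical_set_scope.
Local Open Scope ring_scope.

(* For i < N, the index i among the N + 1 path points. *)
Notation pt i := (widen_ord (leqnSn _) i).

Definition step (R : realType) (N : nat) (s : 'I_N.+1 -> R) (i : 'I_N) : R :=
  s (lift ord0 i) - s (pt i).

Definition twice_differentiable (R : realType) (d : nat) (p : R -> 'rV[R]_d) :=
  (forall x, derivable p x 1) /\ (forall x, derivable (derive1 p) x 1).

(* The scalar p'(x) theta_j; the vector theta_j is the j-th column of theta,
   so 'M[R]_(d, n) plays the role of R^(nd). *)
Definition joint_slope (R : realType) (n d : nat) (p : R -> 'rV[R]_d)
    (theta : 'M[R]_(d, n)) (x : R) (j : 'I_n) : R :=
  (derive1 p x *m col j theta) 0 0.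

Definition feasible (R : realType) (N n d : nat) (s : 'I_N.+1 -> R)
    (p : R -> 'rV[R]_d) (qlo qhi : 'I_n -> R) (theta : 'M[R]_(d, n)) :
    set ('I_N.+1 -> R) :=
  [set sdot | (forall i, 0 <= sdot i) /\
    forall i j,
      - qlo j ^+ 2 <=
        Num.sg (joint_slope p theta (s i) j)
          * joint_slope p theta (s i) j ^+ 2 * sdot i ^+ 2
      <= qhi j ^+ 2].

(* The zero case is explicit since 0^-1 = 0 in R. *)
Definition travel_cost (R : realType) (N : nat) (s sdot : 'I_N.+1 -> R) :
    \bar R :=
  if [exists i : 'I_N, sdot (pt i) == 0] then +oo%E
  else ((\sum_(i < N) step s i / Num.sqrt (sdot (pt i) ^+ 2)) ^+ 2)%:E.

Definition optimal_value (R : realType) (N n d : nat) (s : 'I_N.+1 -> R)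
    (p : R -> 'rV[R]_d) (qlo qhi : 'I_n -> R) (theta : 'M[R]_(d, n)) :
    \bar R :=
  ereal_inf [set travel_cost s sdot | sdot in feasible s p qlo qhi theta].

(* The maximum of a nonempty finite family: the default value F 0 is itself
   a member of the family. *)
Definition max_fam (R : realType) (n : nat) (n_gt0 : (0 < n)%N)
    (F : 'I_n -> R) : R :=
  \big[Num.max/F (Ordinal n_gt0)]_(j < n) F j.

(* Main.v *)
(** The constraint at a path point only says that [sdot_i] times the largest
    ratio of a joint slope to the velocity limit of the same sign is at most 1,
    so the constraints decouple over [i]: this ratio bounds [1 / sdot_i] from
    below, and the bound is approached. Each ratio is a maximum of linear forms
    in [theta], so the infimal travel time is convex and nonnegative, hence so
    is its square. *)

Require Import Defs.
From mathcomp Require Import ring lra.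

Set Implicit Arguments.
Unset Strict Implicit.
Unset Printing Implicit Defensive.

Local Open Scope classical_set_scope.
Local Open Scope ring_scope.

Lemma max_fam_leP (R : realType) (n : nat) (n_gt0 : (0 < n)%N)
    (F : 'I_n -> R) (c : R) :
  max_fam n_gt0 F <= c <-> (forall j, F j <= c).
Proof.
split=> [le_c j|le_c]; last exact: bigmax_le.
exact: le_trans (le_bigmax _ F j) le_c.
Qed.

Lemma le_max_fam (R : realType) (n : nat) (n_gt0 : (0 < n)%N)
    (F : 'I_n -> R) (j : 'I_n) : F j <= max_fam n_gt0 F.
Proof. exact: le_bigmax. Qed.

Lemma max_famZ (R : realType) (n : nat) (n_gt0 : (0 < n)%N)
    (F : 'I_n -> R) (c : R) :
  0 <= c -> max_fam n_gt0 (fun j => c * F j) = c * max_fam n_gt0 F.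
Proof.
move=> c_ge0; rewrite /max_fam.
by rewrite (big_morph ( *%R c) (fun x y => maxr_pMr x y c_ge0) erefl).
Qed.

(** For [lo < 0 < hi] the quotient by the limit of opposite sign is nonpositive, so the maximum
    picks the limit with the sign of [a]. Written without a case split, it is a maximum of two
    linear forms in [a]. *)
Definition velocity_ratio (R : realType) (lo hi a : R) : R :=
  Num.max (a / hi) (a / lo).

Lemma velocity_ratio_ge0 (R : realType) (lo hi a : R) :
  lo < 0 -> 0 < hi -> 0 <= velocity_ratio lo hi a.
Proof.
move=> lo_lt0 hi_gt0; rewrite /velocity_ratio le_max.
have [a_ge0|a_lt0] := leP 0 a; first by rewrite divr_ge0 // ltW.
by rewrite orbC mulr_le0 // ?invr_le0 ltW.
Qed.

Lemma velocity_ratio_convex (R : realType) (lo hi t u a b : R) :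
  0 <= t -> 0 <= u ->
  velocity_ratio lo hi (t * a + u * b) <=
    t * velocity_ratio lo hi a + u * velocity_ratio lo hi b.
Proof.
move=> t_ge0 u_ge0; rewrite /velocity_ratio ge_max !mulrDl -!mulrA.
by apply/andP; split; apply: lerD; apply: ler_wpM2l => //;
  rewrite le_max lexx ?orbT.
Qed.

(** Both sides say [lo <= a * x <= hi]: the signed square is increasing in [a * x], and multiplying
    by [lo] reverses the inequality. For each sign of [a] at least one of the two bounds is
    automatic. *)
Lemma signed_sqr_bounds (R : realType) (lo hi a x : R) :
  lo < 0 -> 0 < hi -> 0 <= x ->
  (- lo ^+ 2 <= Num.sg a * a ^+ 2 * x ^+ 2 <= hi ^+ 2) =
  (velocity_ratio lo hi a * x <= 1).
Proof.
move=> lo_lt0 hi_gt0 x_ge0.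
rewrite /velocity_ratio maxr_pMl // ge_max.
have -> : (a / hi * x <= 1) = (a * x <= hi).
  by rewrite mulrAC ler_pdivrMr // mul1r.
have -> : (a / lo * x <= 1) = (lo <= a * x).
  by rewrite mulrAC ler_ndivrMr // mul1r.
have [a_lt0|a_gt0|->] := ltrgtP a 0; last first.
- by rewrite sgr0 !mul0r oppr_le0 !sqr_ge0 !ltW.
- have ax_ge0 : 0 <= a * x by rewrite mulr_ge0 // ltW.
  rewrite gtr0_sg // mul1r -exprMn ler_sqr ?nnegrE ?(ltW hi_gt0) //.
  rewrite [lo <= _](le_trans (ltW lo_lt0)) //.
  by rewrite (le_trans _ (sqr_ge0 _)) ?oppr_le0 ?sqr_ge0 // andbT.
- have ax_le0 : a * x <= 0 by rewrite mulr_le0_ge0 // ltW.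
  rewrite ltr0_sg // mulN1r mulNr -exprMn lerN2.
  rewrite -(sqrrN (a * x)) -(sqrrN lo) ler_sqr ?nnegrE ?oppr_ge0 ?(ltW lo_lt0) //.
  rewrite lerN2 [a * x <= hi](le_trans ax_le0 (ltW hi_gt0)).
  by rewrite (le_trans _ (sqr_ge0 _)) ?oppr_le0 ?sqr_ge0 // andbT.
Qed.

Lemma joint_slope_linear (R : realType) (n d : nat) (p : R -> 'rV[R]_d)
    (t u : R) (theta1 theta2 : 'M[R]_(d, n)) (x : R) (j : 'I_n) :
  joint_slope p (t *: theta1 + u *: theta2) x j =
  t * joint_slope p theta1 x j + u * joint_slope p theta2 x j.
Proof. by rewrite /joint_slope linearD !linearZ /= mulmxDr -!scalemxAr !mxE. Qed.

(* The reciprocal of the largest admissible velocity at path parameter [x]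
   (0 when every velocity is admissible). *)
Definition min_slowness (R : realType) (n d : nat) (n_gt0 : (0 < n)%N)
    (p : R -> 'rV[R]_d) (qlo qhi : 'I_n -> R) (theta : 'M[R]_(d, n)) (x : R) :
    R :=
  max_fam n_gt0 (fun j =>
    velocity_ratio (qlo j) (qhi j) (joint_slope p theta x j)).

Section MinSlowness.
Context (R : realType) (N n d : nat) (n_gt0 : (0 < n)%N).
Context (p : R -> 'rV[R]_d) (qlo qhi : 'I_n -> R).
Hypotheses (qlo_lt0 : forall j, qlo j < 0) (qhi_gt0 : forall j, 0 < qhi j).
Implicit Types (theta : 'M[R]_(d, n)) (s sdot : 'I_N.+1 -> R).

Local Notation slow := (min_slowness n_gt0 p qlo qhi).

Lemma min_slowness_ge0 theta x : 0 <= slow theta x.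
Proof.
apply: le_trans (le_max_fam n_gt0 _ (Ordinal n_gt0)).
exact: velocity_ratio_ge0.
Qed.

Lemma min_slowness_convex t u theta1 theta2 x : 0 <= t -> 0 <= u ->
  slow (t *: theta1 + u *: theta2) x <= t * slow theta1 x + u * slow theta2 x.
Proof.
move=> t_ge0 u_ge0; apply/max_fam_leP => j; rewrite joint_slope_linear.
apply: le_trans (velocity_ratio_convex _ _ _ _ _ _) _ => //.
by apply: lerD; apply: ler_wpM2l => //; apply: le_max_fam.
Qed.

(** Since the factor [sdot i >= 0] can move inside the maximum, the constraints of all joints merge
    into one bound per path point. *)
Lemma feasibleP s theta sdot :
  feasible s p qlo qhi theta sdot <->
  (forall i, 0 <= sdot i) /\ (forall i, slow theta (s i) * sdot i <= 1).
Proof.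
rewrite /feasible /=; split=> -[sdot_ge0 bnd]; split=> // i.
  rewrite mulrC -max_famZ //; apply/max_fam_leP => j.
  by rewrite mulrC -signed_sqr_bounds.
move=> j; rewrite signed_sqr_bounds //.
by apply: le_trans (bnd i); apply: ler_wpM2r => //; apply: le_max_fam.
Qed.

Definition min_time s theta : R :=
  \sum_(i < N) step s i * slow theta (s (pt i)).

Variable s : 'I_N.+1 -> R.
Hypothesis s_incr : forall i : 'I_N, 0 < step s i.

Lemma min_time_ge0 theta : 0 <= min_time s theta.
Proof.
by apply: sumr_ge0 => i _; rewrite mulr_ge0 ?min_slowness_ge0 // ltW.
Qed.

Lemma min_time_convex t u theta1 theta2 : 0 <= t -> 0 <= u ->
  min_time s (t *: theta1 + u *: theta2) <=
    t * min_time s theta1 + u * min_time s theta2.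
Proof.
move=> t_ge0 u_ge0; rewrite /min_time !mulr_sumr -big_split /=.
apply: ler_sum => i _; rewrite !(mulrCA _ (step s i)) -mulrDr.
by apply: ler_wpM2l; [exact: ltW | exact: min_slowness_convex].
Qed.

(** If some velocity before the last point vanishes, the cost is infinite. Otherwise the merged
    constraint reads [slow <= 1 / sdot], and the sums compare term by term. *)
Lemma min_time_lbound theta sdot : feasible s p qlo qhi theta sdot ->
  ((min_time s theta ^+ 2)%:E <= travel_cost s sdot)%E.
Proof.
move=> /feasibleP[sdot_ge0 bnd]; rewrite /travel_cost.
case: ifPn => [_|/existsPn sdot_neq0]; first exact: leey.
have le_time : min_time s theta <=
    \sum_(i < N) step s i / Num.sqrt (sdot (pt i) ^+ 2).
  apply: ler_sum => i _; rewrite sqrtr_sqr ger0_norm //.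
  apply: ler_wpM2l; first exact: ltW.
  by rewrite -[_^-1]mul1r ler_pdivlMr // lt0r sdot_neq0 sdot_ge0.
rewrite lee_fin ler_sqr // nnegrE ?min_time_ge0 //.
exact: le_trans (min_time_ge0 theta) le_time.
Qed.

(* The fastest profile [1 / slow] is infinite where the slowness vanishes, hence
   the perturbation by [eps]. *)
Lemma min_time_approx theta (eps : R) : 0 < eps ->
  (optimal_value s p qlo qhi theta <=
    ((min_time s theta + eps * \sum_(i < N) step s i) ^+ 2)%:E)%E.
Proof.
move=> eps_gt0.
pose sdot i := (slow theta (s i) + eps)^-1.
have den_gt0 i : 0 < slow theta (s i) + eps.
  by rewrite ltr_wpDl // min_slowness_ge0.
have sdot_gt0 i : 0 < sdot i by rewrite invr_gt0.
apply: ereal_inf_lbound; exists sdot.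
  apply/feasibleP; split=> i; first exact: ltW.
  by rewrite ler_pdivrMr // mul1r lerDl ltW.
rewrite /travel_cost ifF; last first.
  by apply/negbTE/existsPn => i; rewrite gt_eqF.
congr ((_ ^+ 2)%:E); rewrite /min_time mulr_sumr -big_split /=.
apply: eq_bigr => i _.
by rewrite sqrtr_sqr gtr0_norm // invrK mulrDr [eps * _]mulrC.
Qed.

Lemma optimal_valueE theta :
  optimal_value s p qlo qhi theta = (min_time s theta ^+ 2)%:E.
Proof.
apply/eqP; rewrite eq_le; apply/andP; split; last first.
  by apply: le_ereal_inf_tmp => _ [sdot fsdot <-]; apply: min_time_lbound.
(* The infimum need not be attained, so the upper bound is shown up to an arbitrary [e > 0]. *)
apply/lee_addgt0Pr => e e_gt0.
set T := min_time s theta; set L := \sum_(i < N) step s i.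
have T_ge0 : 0 <= T by exact: min_time_ge0.
have L_ge0 : 0 <= L by apply: sumr_ge0 => i _; exact: ltW.
(* The [+ 1] makes the divisor of [e] positive when [T] and [L] are only known to be nonnegative. *)
have K_gt0 : 0 < 2 * T * L + L ^+ 2 + 1 by nra.
(* With [eps <= 1], [(T + eps L)^2 <= T^2 + eps (2 T L + L^2)]. *)
pose eps := Num.min 1 (e / (2 * T * L + L ^+ 2 + 1)).
have eps_gt0 : 0 < eps by rewrite lt_min ltr01 divr_gt0.
have eps_le1 : eps <= 1 by rewrite ge_min lexx.
have eps_le : eps * (2 * T * L + L ^+ 2 + 1) <= e.
  by rewrite -ler_pdivlMr // ge_min lexx orbT.
apply: le_trans (min_time_approx theta eps_gt0) _.
rewrite -EFinD lee_fin -/T -/L.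
have : eps ^+ 2 * L ^+ 2 <= eps * L ^+ 2.
  by apply: ler_wpM2r; [exact: sqr_ge0 | rewrite expr2 ger_pMl].
have -> : (T + eps * L) ^+ 2 =
    T ^+ 2 + eps * (2 * T * L) + eps ^+ 2 * L ^+ 2 by ring.
lra.
Qed.

End MinSlowness.

(** The gap between the two sides is [t * u * (a - b) ^+ 2]. *)
Lemma sqr_convex (R : realType) (t u a b : R) :
  0 <= t -> 0 <= u -> t + u = 1 ->
  (t * a + u * b) ^+ 2 <= t * a ^+ 2 + u * b ^+ 2.
Proof.
move=> t_ge0 u_ge0 tu1; rewrite -subr_ge0.
have uE : u = 1 - t by rewrite -tu1 addrC addKr.
have -> : t * a ^+ 2 + u * b ^+ 2 - (t * a + u * b) ^+ 2 =
    t * u * (a - b) ^+ 2 by rewrite uE; ring.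
by rewrite mulr_ge0 ?sqr_ge0 ?mulr_ge0.
Qed.

Theorem theorem3 (R : realType) (N n d : nat)
    (N_gt0 : (0 < N)%N) (n_gt0 : (0 < n)%N) (d_gt0 : (0 < d)%N)
    (s : 'I_N.+1 -> R)
    (s_first : s ord0 = 0) (s_last : s ord_max = 1)
    (s_incr : forall i : 'I_N, 0 < step s i)
    (p : R -> 'rV[R]_d) (p_diff : twice_differentiable p)
    (qlo qhi : 'I_n -> R)
    (qlo_lt0 : forall j, qlo j < 0) (qhi_gt0 : forall j, 0 < qhi j) :
  (forall theta : 'M[R]_(d, n),
     optimal_value s p qlo qhi theta =
     ((\sum_(i < N)
         max_fam n_gt0 (fun j : 'I_n =>
           Num.max
             (step s i * joint_slope p theta (s (pt i)) j / qhi j)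
             (step s i * joint_slope p theta (s (pt i)) j / qlo j))) ^+ 2)%:E)
  /\
  convex_function [set: convex_lmodType 'M[R]_(d, n)]
    (fun theta => fine (optimal_value s p qlo qhi theta)).
Proof.
split=> [theta|t theta1 theta2 _ _].
  rewrite (optimal_valueE n_gt0) //; congr ((_ ^+ 2)%:E).
  apply: eq_bigr => i _; rewrite -max_famZ ?(ltW (s_incr i)) //.
  congr max_fam; apply/funext => j.
  by rewrite /velocity_ratio maxr_pMr ?(ltW (s_incr i)) // !mulrA.
(* The value is finite, so [fine] discards nothing. *)
rewrite !(optimal_valueE n_gt0) //=.
have t_ge0 : 0 <= t%:num by [].
have u_ge0 : 0 <= 1 - t%:num by rewrite subr_ge0.
have time_ge0 := min_time_ge0 n_gt0 p qlo_lt0 qhi_gt0 s_incr.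
(* The middle term is the square of the convex combination of the two minimal times; it is reached
   by convexity of [min_time], squaring being monotone on nonnegative reals. *)
apply: le_trans (sqr_convex _ _ t_ge0 u_ge0 _); last by rewrite addrC subrK.
rewrite ler_sqr ?nnegrE ?time_ge0 //; last first.
  by rewrite addr_ge0 // mulr_ge0.
exact: min_time_convex.
Qed.
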